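(* Let $G=1+\mathcal{A}$ be a countable discrete algebra group associated with a nil $\Bbbk$-algebra $\mathcal{A}$. Then the regular character $\lambda_{G}$ is an indecomposable supercharacter of $G$ if and only if $\{1\}$ is the unique finite superclass of $G$.
   Context: Let $\Bbbk$ be a countable discrete field and $\mathcal{A}$ a countable associative nil $\Bbbk$-algebra (every element is nilpotent; $\mathcal{A}$ need not be finite-dimensional). The algebra group $G=1+\mathcal{A}$ is the set of formal objects $1+a$ ($a\in\mathcal{A}$) with multiplication $(1+a)(1+b)=1+a+b+ab$, equipped with the discrete topology. A superclass of $G$ is a set $1+GaG=\{1+gah: g,h\in G\}$ with $a\in\mathcal{A}$. A function $\varphi\colon G\to\mathbb{C}$ is positive definite if $\varphi(g^{-1})=\overline{\varphi(g)}$ for all $g\in G$ and every matrix $[\varphi(g_ig_j^{-1})]_{i,j}$ ($g_1,\dots,g_m\in G$) is nonnegative. A supercharacter of $G$ is a positive definite function $\varphi\colon G\to\mathbb{C}$ with $\varphi(1)=1$ that is constant on superclasses. The supercharacters form a convex set $\mathrm{SCh}(G)$; its extreme points are the indecomposable supercharacters. The regular character of $G$ is $\lambda_G(g)=\delta_{g,1}$ (equal to $1$ if $g=1$ and $0$ otherwise); it is a supercharacter. *)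

(* Defs.v *)
From HB Require Import structures.
From mathcomp Require Import all_boot all_order all_algebra.
From mathcomp Require Import complex.
From mathcomp Require Import all_classical all_reals.

Set Implicit Arguments.
Unset Strict Implicit.
Unset Printing Implicit Defensive.

Import Order.TTheory GRing.Theory Num.Theory.
Local Open Scope classical_set_scope.
Local Open Scope ring_scope.

Reserved Notation "x ** y" (at level 40, left associativity).

(* MathComp algebras are unital, and a nonzero nil algebra never is; hence a
   separate structure of associative, not necessarily unital, algebra. *)
HB.mixin Record Lmodule_isNonUnitalAlgebra (K : fieldType) A
    of GRing.Lmodule K A := {
  numul : A -> A -> A;
  numulA : associative numul;
  numulDl : left_distributive numul +%R;
  numulDr : right_distributive numul +%R;
  numulZl : forall (c : K) (x y : A), numul (c *: x) y = c *: numul x y;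
  numulZr : forall (c : K) (x y : A), numul x (c *: y) = c *: numul x y
}.

#[short(type="nonUnitalAlgType")]
HB.structure Definition NonUnitalAlgebra (K : fieldType) :=
  { A of GRing.Lmodule K A & Lmodule_isNonUnitalAlgebra K A }.

Notation "x ** y" := (numul x y) : ring_scope.

(* The exponent is shifted, as there is no 0-th power: nupowS x n = x^(n+1). *)
Definition nupowS (K : fieldType) (A : nonUnitalAlgType K) (x : A) (n : nat) :=
  iter n (numul x) x.

HB.mixin Record NonUnitalAlgebra_isNil (K : fieldType) A
    of NonUnitalAlgebra K A := {
  nu_nilpotent : forall x : A, exists n : nat, nupowS x n = 0
}.

#[short(type="nilAlgType")]
HB.structure Definition NilAlgebra (K : fieldType) :=
  { A of NonUnitalAlgebra K A & NonUnitalAlgebra_isNil K A }.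

Section NilAlgebraTheory.
Variables (K : fieldType) (A : nilAlgType K).
Implicit Types x y a b : A.

Lemma numul0r x : 0 ** x = 0.
Proof. by rewrite -{1}(scale0r (0 : A)) numulZl scale0r. Qed.

Lemma numulr0 x : x ** 0 = 0.
Proof. by rewrite -{1}(scale0r (0 : A)) numulZr scale0r. Qed.

Lemma numul_sumr x n (F : 'I_n -> A) :
  x ** (\sum_(i < n) F i) = \sum_(i < n) x ** F i.
Proof. by apply: (big_morph (numul x)); [exact: numulDr | exact: numulr0]. Qed.

Lemma numul_suml x n (F : 'I_n -> A) :
  (\sum_(i < n) F i) ** x = \sum_(i < n) F i ** x.
Proof.
apply: (big_morph (fun y => y ** x)); last exact: numul0r.
by move=> y z; rewrite numulDl.
Qed.

Lemma nupowS_comm x n : nupowS x n ** x = x ** nupowS x n.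
Proof. by elim: n => //= n IHn; rewrite -numulA IHn. Qed.

Lemma nilindex_subproof x : exists n, nupowS x n == 0.
Proof. by have [n xn0] := nu_nilpotent x; exists n; rewrite xn0. Qed.

Definition nilindex x : nat := ex_minn (nilindex_subproof x).

Lemma nupowS_nilindex x : nupowS x (nilindex x) = 0.
Proof. by rewrite /nilindex; case: ex_minnP => n /eqP. Qed.

(* (1 + x)^-1 = 1 + nuqinv x, by the (finite) geometric series. *)
Definition nuqinv x : A :=
  \sum_(i < nilindex x) (-1) ^+ i.+1 *: nupowS x i.

Lemma nuqinv_comm x : nuqinv x ** x = x ** nuqinv x.
Proof.
rewrite /nuqinv numul_suml numul_sumr; apply: eq_bigr => i _.
by rewrite numulZl numulZr nupowS_comm.
Qed.

Lemma nuqinvr x : x + nuqinv x + x ** nuqinv x = 0.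
Proof.
have tele n : x + \sum_(i < n) (-1) ^+ i.+1 *: nupowS x i
    + x ** (\sum_(i < n) (-1) ^+ i.+1 *: nupowS x i) = (-1) ^+ n *: nupowS x n.
  elim: n => [|n IHn]; first by rewrite !big_ord0 numulr0 !addr0 scale1r.
  rewrite !big_ord_recr /= numulDr numulZr (addrA x) addrACA IHn.
  by rewrite addrA {1}exprS mulN1r scaleNr subrr add0r.
by rewrite tele nupowS_nilindex scaler0.
Qed.

Lemma nuqinvl x : nuqinv x + x + nuqinv x ** x = 0.
Proof. by rewrite nuqinv_comm (addrC _ x) nuqinvr. Qed.

End NilAlgebraTheory.

(* OnePlus a is the formal object 1 + a. *)
Record algGroup (K : fieldType) (A : nilAlgType K) :=
  OnePlus { alg_part : A }.

Section AlgGroup.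
Variables (K : fieldType) (A : nilAlgType K).
Implicit Types g h : algGroup A.

HB.instance Definition _ := [isNew for @alg_part K A].
HB.instance Definition _ := [Choice of algGroup A by <:].

Definition algGroup_one : algGroup A := OnePlus 0.
Definition algGroup_mul g h : algGroup A :=
  OnePlus (alg_part g + alg_part h + alg_part g ** alg_part h).
Definition algGroup_inv g : algGroup A := OnePlus (nuqinv (alg_part g)).

Lemma algGroup_mulA : associative algGroup_mul.
Proof.
move=> [a] [b] [c]; congr OnePlus => /=.
rewrite !numulDl !numulDr numulA !addrA.
by rewrite [LHS](ACl (1*2*5*3*6*4*7)).
Qed.

Lemma algGroup_mul1g : left_id algGroup_one algGroup_mul.
Proof. by case=> a; congr OnePlus; rewrite /= numul0r add0r addr0. Qed.

Lemma algGroup_mulg1 : right_id algGroup_one algGroup_mul.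
Proof. by case=> a; congr OnePlus; rewrite /= numulr0 !addr0. Qed.

Lemma algGroup_mulVg : left_inverse algGroup_one algGroup_inv algGroup_mul.
Proof. by case=> a; congr OnePlus; exact: nuqinvl. Qed.

Lemma algGroup_mulgV : right_inverse algGroup_one algGroup_inv algGroup_mul.
Proof. by case=> a; congr OnePlus; exact: nuqinvr. Qed.

HB.instance Definition _ := isGroup.Build (algGroup A)
  algGroup_mulA algGroup_mul1g algGroup_mulg1 algGroup_mulVg algGroup_mulgV.

Definition lact g (a : A) : A := a + alg_part g ** a.
Definition ract (a : A) g : A := a + a ** alg_part g.

Definition superclass_of (a : A) : set (algGroup A) :=
  [set x | exists g h, x = OnePlus (ract (lact g a) h)].

Definition superclass : set (set (algGroup A)) := range superclass_of.

End AlgGroup.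

(* The order of R[i] is partial: 0 <= z means that z is real and nonnegative. *)
Definition nonneg_mx (R : realType) (m : nat) (M : 'M[R[i]]_m) : Prop :=
  forall v : 'cV[R[i]]_m, 0 <= ((map_mx Num.conj v)^T *m M *m v) 0 0.

Definition positive_definite (R : realType) (G : groupType) (phi : G -> R[i]) :
    Prop :=
  (forall g : G, phi (g^-1)%g = (phi g)^*) /\
  (forall (m : nat) (g : 'I_m -> G),
     nonneg_mx (\matrix_(i, j) phi (g i * (g j)^-1)%g)).

(* SCh(G) *)
Definition supercharacter (R : realType) (K : fieldType) (A : nilAlgType K) :
    set (algGroup A -> R[i]) :=
  [set phi | [/\ positive_definite phi, phi 1%g = 1 &
    forall C, superclass C -> forall x y, C x -> C y -> phi x = phi y]].

Definition extreme_points (R : realType) (T : Type) (S : set (T -> R[i])) :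
    set (T -> R[i]) :=
  [set f | S f /\ forall f1 f2 (t : R), S f1 -> S f2 -> 0 < t < 1 ->
    (forall x, f x = t%:C%C * f1 x + (1 - t)%:C%C * f2 x) -> f1 = f /\ f2 = f].

Definition indecomposable_supercharacter (R : realType) (K : fieldType)
    (A : nilAlgType K) : set (algGroup A -> R[i]) :=
  extreme_points (@supercharacter R K A).

Definition regular_character (R : realType) (G : groupType) (g : G) : R[i] :=
  (g == 1%g)%:R.

(* Main.v *)
(* If lambda = t f1 + (1 - t) f2 with f1, f2 positive definite, then the Gram
   matrices of t f1 lie between 0 and the identity, which makes f1 square
   summable; being constant on superclasses, f1 vanishes on the infinite ones.
   Conversely, if C <> {1} is a finite superclass, then so is C^-1, and lambda
   is the midpoint of the two supercharacters
   lambda +- (1_C + 1_(C^-1)) / (2 |C|). These are positive definite, being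
   averages over d in C of autocorrelations of delta_1 +- delta_d. *)
Require Import Defs.
From mathcomp Require Import all_boot all_order all_algebra.
From mathcomp Require Import complex ring.
From mathcomp Require Import all_classical all_reals.

Set Implicit Arguments.
Unset Strict Implicit.
Unset Printing Implicit Defensive.

Import Order.TTheory GRing.Theory Num.Theory.
Local Open Scope classical_set_scope.
Local Open Scope ring_scope.

(** * Positive definite functions on an arbitrary group *)

Section PositiveDefinite.
Variables (R : realType) (G : groupType).
Local Notation C := R[i].
Implicit Types (g h d : G) (phi psi f : G -> C).

Lemma quad_formE m (M : 'M[C]_m) (v : 'cV[C]_m) :
  ((map_mx Num.conj v)^T *m M *m v) 0 0 =
  \sum_j \sum_i (v i 0)^* * M i j * v j 0.
Proof.
rewrite mxE; apply: eq_bigr => j _; rewrite mxE mulr_suml.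
by apply: eq_bigr => i _; rewrite !mxE.
Qed.

(** Substitution x = hy in a finitely supported sum. The list [t] may be larger than h^-1 s, since
    the extra terms vanish; hence one [t] can serve several translations. *)
Lemma sum_translate (V : nmodType) (s t : seq G) h (F : G -> V) :
    uniq s -> uniq t -> {in s, forall x, (h^-1 * x)%g \in t} ->
    (forall x, x \notin s -> F x = 0) ->
  \sum_(x <- s) F x = \sum_(y <- t) F (h * y)%g.
Proof.
move=> us ut sub_t F0; rewrite -(big_map (fun y => h * y)%g xpredT F).
rewrite -[RHS](big_rmcond_in (mem s)) => [|x _ /F0 //]; rewrite -big_filter.
apply/perm_big/uniq_perm=> //.
  by apply/filter_uniq; rewrite map_inj_uniq //; apply: mulgI.
move=> x; rewrite mem_filter /=; case: (boolP (x \in s)) => //= xs.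
by apply/esym/mapP; exists (h^-1 * x)%g; rewrite ?sub_t // mulVKg.
Qed.

Lemma autocorrelation_translate (s t : seq G) psi g h :
    uniq s -> uniq t -> {in s, forall x, (h^-1 * x)%g \in t} ->
    (forall x, x \notin s -> psi x = 0) ->
  \sum_(x <- s) psi (g * h^-1 * x)%g * (psi x)^* =
  \sum_(y <- t) psi (g * y)%g * (psi (h * y)%g)^*.
Proof.
move=> us ut st psi0; rewrite (sum_translate us ut st) => [|x /psi0->].
  by apply: eq_bigr => y _; rewrite -mulgA mulKg.
by rewrite rmorph0 mulr0.
Qed.

(** The entry at g_i g_j^-1 is the inner product of y |-> psi(g_i y) and y |-> psi(g_j y), so the
    quadratic form is the sum over y of |sum_i conj(v_i) psi(g_i y)|^2. *)
Lemma autocorrelation_pd (s : seq G) psi :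
    uniq s -> (forall x, x \notin s -> psi x = 0) ->
  positive_definite (fun g => \sum_(x <- s) psi (g * x)%g * (psi x)^*).
Proof.
move=> us psi0; split=> [g|m g v].
  (* A common list for the substitutions by g and by 1, so that the values at g^-1 and at g become
     sums over the same [t], conjugate term by term. *)
  pose t := undup ([seq (g^-1 * x)%g | x <- s] ++ s).
  have ut : uniq t by exact: undup_uniq.
  have st1 : {in s, forall x, (1^-1 * x)%g \in t}.
    by move=> x xs; rewrite invg1 mul1g mem_undup mem_cat xs orbT.
  have stg : {in s, forall x, (g^-1 * x)%g \in t}.
    by move=> x xs; rewrite mem_undup mem_cat map_f.
  have := autocorrelation_translate 1%g us ut stg psi0.
  have := autocorrelation_translate g us ut st1 psi0.
  rewrite invg1 mulg1 mul1g => -> ->.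
  rewrite rmorph_sum; apply: eq_bigr => y _.
  by rewrite rmorphM /= conjCK mulrC mul1g.
pose t := undup (flatten [seq [seq ((g j)^-1 * x)%g | x <- s] | j : 'I_m]).
have ut : uniq t by exact: undup_uniq.
have st j : {in s, forall x, ((g j)^-1 * x)%g \in t}.
  move=> x xs; rewrite mem_undup; apply/flatten_mapP; exists j => //.
    by rewrite mem_enum.
  exact: map_f.
rewrite quad_formE.
under eq_bigr => j _ do under eq_bigr => i _ do
  rewrite mxE (autocorrelation_translate (g i) us ut (st j) psi0)
          mulr_sumr mulr_suml.
under eq_bigr => j _ do rewrite exchange_big.
rewrite exchange_big /=; apply: sumr_ge0 => y _.
rewrite (_ : \sum_j _ = (\sum_i (v i 0)^* * psi (g i * y)%g) *
                        (\sum_i (v i 0)^* * psi (g i * y)%g)^*).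
  exact: mul_conjC_ge0.
rewrite rmorph_sum mulr_sumr; apply: eq_bigr => j _.
rewrite mulr_suml; apply: eq_bigr => i _.
by rewrite rmorphM /= conjCK !mulrA (mulrAC _ (v j 0)).
Qed.

Lemma pdZ (c : C) phi :
  0 <= c -> positive_definite phi -> positive_definite (fun g => c * phi g).
Proof.
move=> c0 [phiV phi_ge0]; split=> [g|m g v].
  by rewrite rmorphM /= phiV (conj_Creal (ger0_real c0)).
rewrite (_ : \matrix_(i, j) _ = c *: \matrix_(i, j) phi (g i * (g j)^-1)%g).
  by rewrite -scalemxAr -scalemxAl mxE mulr_ge0 //; apply: phi_ge0.
by apply/matrixP=> i j; rewrite !mxE.
Qed.

Lemma pd_sum (I : eqType) (r : seq I) (phi : I -> G -> C) :
  {in r, forall i, positive_definite (phi i)} ->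
  positive_definite (fun g => \sum_(i <- r) phi i g).
Proof.
move=> pd; split=> [g|m g v].
  by rewrite rmorph_sum; apply: eq_big_seq => i /pd[].
rewrite (_ : \matrix_(i, j) _ =
  \sum_(k <- r) \matrix_(i, j) phi k (g i * (g j)^-1)%g).
  rewrite mulmx_sumr mulmx_suml summxE big_seq.
  by apply: sumr_ge0 => k /pd[_]; apply.
by apply/matrixP=> i j; rewrite summxE mxE; apply: eq_bigr => k _; rewrite mxE.
Qed.

Lemma regular_character_pd : positive_definite (@regular_character R G).
Proof.
have := @autocorrelation_pd [:: 1%g] (@regular_character R G) isT.
rewrite (_ : (fun g => _) = @regular_character R G); last first.
  apply/funext => g; rewrite big_seq1 mulg1 /regular_character eqxx.
  by rewrite rmorph1 mulr1.
by apply=> x; rewrite inE /regular_character => /negPf ->.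
Qed.

(* The autocorrelation of delta_1 + e delta_d. *)
Lemma perturbed_regular_pd (e : C) d : e^* = e -> e * e = 1 -> d != 1%g ->
  positive_definite (fun g => 2 * regular_character R g +
                              e * ((g == d)%:R + ((g^-1)%g == d)%:R)).
Proof.
move=> eJ ee d1.
pose psi g : C := (g == 1%g)%:R + e * (g == d)%:R.
have := @autocorrelation_pd [:: 1%g; d] psi.
rewrite (_ : (fun g => _) = fun g => 2 * regular_character R g +
    e * ((g == d)%:R + ((g^-1)%g == d)%:R)); last first.
  apply/funext => g; rewrite big_cons big_seq1 /psi mulg1 !eqxx.
  have d1' : (1 == d)%g = false by rewrite eq_sym (negPf d1).
  rewrite (negPf d1) d1' mulr0 addr0 add0r mulr1 rmorph1 eJ.
  have -> : (g * d == d)%g = (g == 1)%g.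
    by rewrite -[X in _ == X]mul1g (inj_eq (mulIg _)).
  rewrite mulg_eq1 eqg_invLR /regular_character.
  rewrite mulr1 mulrDl [_ * _ * e]mulrAC ee.
  by ring.
apply; first by rewrite /= inE eq_sym d1.
move=> x; rewrite !inE negb_or => /andP[/negPf x1 /negPf xd].
by rewrite /psi x1 xd mulr0 addr0.
Qed.

(** From 0 <= M <= 1 follows M^2 <= M, and since M is Hermitian the k-th diagonal entry of M^2 is
    the left-hand sum. *)
Lemma psd_contraction m (M : 'M[C]_m) k :
    (forall i j, M j i = (M i j)^*) ->
    nonneg_mx M -> nonneg_mx (1%:M - M) ->
  \sum_i `|M i k| ^+ 2 <= M k k.
Proof.
move=> MJ M_ge0 N_ge0.
have MH : (map_mx Num.conj M)^T = M by apply/matrixP=> i j; rewrite !mxE -MJ.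
pose N := 1%:M - M.
have NH : (map_mx Num.conj N)^T = N.
  by rewrite /N map_mxB linearB /= MH map_mx1 trmx1.
pose e : 'cV[C]_m := delta_mx k 0.
pose e' : 'rV[C]_m := delta_mx 0 k.
have eH : (map_mx Num.conj e)^T = e'.
  by rewrite map_delta_mx trmx_delta.
(* Testing M on N e and N on M e yields the k-th diagonal entries of NMN and MNM, without any square
   root of M. *)
have := addr_ge0 (M_ge0 (N *m e)) (N_ge0 (M *m e)).
rewrite !map_mxM !trmx_mul MH NH eH -/N.
(* M - M^2 = (1 - M) M (1 - M) + M (1 - M) M *)
have split : N *m M *m N + M *m N *m M = M - M *m M.
  have -> : N *m M = M *m N.
    by rewrite /N mulmxBl mulmxBr mul1mx mulmx1.
  by rewrite -mulmxDr /N subrK mulmx1 mulmxBr mulmx1.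
have splitE : (e' *m (M - M *m M) *m e) 0 0 =
    (e' *m N *m M *m (N *m e)) 0 0 + (e' *m M *m N *m (M *m e)) 0 0.
  by rewrite -split mulmxDr mulmxDl [LHS]mxE !mulmxA.
rewrite -splitE.
rewrite -rowE -colE !mxE subr_ge0.
rewrite (_ : \sum_j _ = \sum_i `|M i k| ^+ 2) //; apply: eq_bigr => i _.
by rewrite (MJ i k) normCKC.
Qed.

(** The column of the Gram matrix of t f1 at the point 1 has squared norm at most t, yet it contains
    the value t f1(x) once for each chosen point of [D]. As [D] is infinite, n |t f1(x)|^2 <= t for
    every n. *)
Lemma regular_component_eq0 (f1 f2 : G -> C) (t : R) (D : set G) x :
    positive_definite f1 -> positive_definite f2 -> f1 1%g = 1 -> 0 < t < 1 ->
    (forall g, regular_character R g = t%:C%C * f1 g + (1 - t)%:C%C * f2 g) ->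
    infinite_set D -> ~ D 1%g -> (forall y, D y -> f1 y = f1 x) ->
  f1 x = 0.
Proof.
move=> pd1 pd2 f11 /andP[t0 t1] fE Dinf D1 Dconst.
have tC0 : 0 < t%:C%C :> C by rewrite ltcR.
have [f1V M_ge0] := pdZ (ltW tC0) pd1.
have s0 : 0 <= (1 - t)%:C%C :> C by rewrite lecR subr_ge0 ltW.
have [_ N_ge0] := pdZ s0 pd2.
have bound n : `|t%:C%C * f1 x| ^+ 2 *+ n <= t%:C%C :> C.
  have [B BD nB] := infinite_set_fset n Dinf.
  have B1 : 1%g \notin finmap.enum_fset B by apply/negP => /BD.
  (* With 1 listed first, column 0 of the matrix [M] below consists of the values t f1(g_i), and its
     diagonal entry is t. *)
  pose s := 1%g :: finmap.enum_fset B.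
  have us : uniq s by rewrite /= B1 finmap.fset_uniq.
  pose g (i : 'I_(size s)) := nth 1%g s i.
  have g_inj : injective g.
    by move=> i j /eqP; rewrite nth_uniq // => /eqP/val_inj.
  pose M := \matrix_(i, j) (t%:C%C * f1 (g i * (g j)^-1)%g).
  have MJ i j : M j i = (M i j)^*.
    by rewrite !mxE -f1V invgF.
  (* The points g_i are distinct, so the Gram matrix of the regular character is the identity and 1
     - M is that of (1 - t) f2. *)
  have N1M : nonneg_mx (1%:M - M).
    rewrite (_ : _ - _ = \matrix_(i, j) ((1 - t)%:C%C * f2 (g i * (g j)^-1)%g)).
      exact: N_ge0.
    apply/matrixP => i j; rewrite !mxE; apply/eqP.
    rewrite subr_eq addrC -fE /regular_character mulg_eq1 invgK.
    by rewrite (inj_eq g_inj).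
  have := psd_contraction ord0 MJ (M_ge0 _ _) N1M.
  rewrite big_ord_recl !mxE mulgV f11 mulr1; apply: le_trans.
  rewrite (eq_bigr (fun=> `|t%:C%C * f1 x| ^+ 2)) => [|i _]; last first.
    rewrite mxE /g /= invg1 mulg1 Dconst //.
    by apply: BD; apply: mem_nth; exact: ltn_ord.
  rewrite sumr_const card_ord -[leLHS]add0r lerD ?exprn_ge0 //.
  by rewrite ler_wpMn2l ?exprn_ge0.
apply: contrapT => /eqP fx0.
have z0 : 0 < `|t%:C%C * f1 x| ^+ 2.
  by rewrite exprn_gt0 // normr_gt0 mulf_neq0 // gt_eqF.
(* Passing to a real number makes the Archimedean property available. *)
have [r rE] : exists r : R, `|t%:C%C * f1 x| ^+ 2 = r%:C%C.
  by exists (complex.Re (`|t%:C%C * f1 x| ^+ 2)); rewrite RRe_real // gtr0_real.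
rewrite rE ltcR in z0 bound.
have := bound (Num.bound (t / r)).
rewrite -rmorphMn /= lecR leNgt -mulr_natl -ltr_pdivrMr //.
by rewrite archi_boundP // divr_ge0 ?ltW.
Qed.

End PositiveDefinite.

Lemma sum_eq_indicator (V : nzRingType) (T : eqType) (s : seq T) x :
  uniq s -> \sum_(y <- s) (x == y)%:R = (x \in s)%:R :> V.
Proof.
move=> us; rewrite -natr_sum -count_uniq_mem // -sum1_count [in RHS]big_mkcond.
by congr (_%:R); apply: eq_bigr => y _; rewrite /= eq_sym; case: eqP.
Qed.

(** * Superclasses as orbits, and supercharacters near the regular one *)

Section Superclass.
Variables (R : realType) (K : fieldType) (A : nilAlgType K).
Implicit Types (x y g h : algGroup A) (a : A).

(** This and the next lemmas make [lact] and [ract] commuting left and right actions, whence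
    superclasses partition the group. *)
Lemma lactM g h a : lact (g * h)%g a = lact g (lact h a).
Proof.
rewrite /lact /= !numulDl numulDr numulA -!addrA; congr (_ + _).
by rewrite addrCA.
Qed.

Lemma ractM g h a : ract a (g * h)%g = ract (ract a g) h.
Proof. by rewrite /ract /= !numulDr numulDl numulA !addrA. Qed.

Lemma lact_ract g h a : lact g (ract a h) = ract (lact g a) h.
Proof. by rewrite /lact /ract numulDr numulDl numulA addrACA. Qed.

Lemma lact1 a : lact 1%g a = a.
Proof. by rewrite /lact numul0r addr0. Qed.

Lemma ract1 a : ract a 1%g = a.
Proof. by rewrite /ract numulr0 addr0. Qed.

Lemma lact0 g : lact g 0 = 0.
Proof. by rewrite /lact numulr0 addr0. Qed.

Lemma ract0 g : ract 0 g = 0.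
Proof. by rewrite /ract numul0r addr0. Qed.

Lemma superclass_of_refl a : superclass_of a (OnePlus a).
Proof. by exists 1%g, 1%g; rewrite lact1 ract1. Qed.

Lemma superclass_of_sym a b :
  superclass_of a (OnePlus b) -> superclass_of b (OnePlus a).
Proof.
move=> [g] [h] [->]; exists (g^-1)%g, (h^-1)%g; congr OnePlus.
by rewrite lact_ract -lactM mulVg lact1 -ractM mulgV ract1.
Qed.

Lemma superclass_of_trans a b c : superclass_of a (OnePlus b) ->
  superclass_of b (OnePlus c) -> superclass_of a (OnePlus c).
Proof.
move=> [g] [h] [->] [g'] [h'] [->]; exists (g' * g)%g, (h * h')%g.
by rewrite lact_ract lactM ractM.
Qed.

Lemma superclass_of0 : superclass_of (0 : A) = [set 1%g].
Proof.
apply/seteqP; split=> x /=; first by move=> [g] [h] ->; rewrite lact0 ract0.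
by move=> ->; exact: superclass_of_refl.
Qed.

Lemma alg_part_inv x : alg_part x^-1%g = - ract (alg_part x) x^-1%g.
Proof.
apply/eqP; rewrite -addr_eq0 /ract addrA [_ + alg_part x]addrC.
exact/eqP/(congr1 (@alg_part K A) (mulgV x)).
Qed.

Lemma lactN g a : lact g (- a) = - lact g a.
Proof. by rewrite /lact -scaleN1r numulZr -scalerDr scaleN1r. Qed.

Lemma ractN g a : ract (- a) g = - ract a g.
Proof. by rewrite /ract -scaleN1r numulZl -scalerDr scaleN1r. Qed.

(* With y = 1 + gah one has y^-1 = 1 - gah y^-1, and -a = (x^-1 - 1) x. *)
Lemma superclass_of_inv x y : superclass_of (alg_part x) y ->
  superclass_of (alg_part x^-1%g) y^-1%g.
Proof.
move=> [g] [h] yE; exists g, (x * (h * y^-1))%g; apply: val_inj.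
change (alg_part y^-1%g = ract (lact g (alg_part x^-1%g)) (x * (h * y^-1))%g).
rewrite !alg_part_inv lactN ractN.
rewrite lact_ract -ractM mulKg ractM; congr (- ract _ _).
by rewrite yE.
Qed.

(** Serves to show that the indicator function of a superclass is constant on superclasses. *)
Lemma eq_superclass (S : set (algGroup A)) x y z :
    superclass S -> S x -> S y ->
  superclass_of (alg_part z) x <-> superclass_of (alg_part z) y.
Proof.
move=> [a _ <-]; case: x y => [b] [c] ab ac; split=> H.
  exact: superclass_of_trans H (superclass_of_trans (superclass_of_sym ab) ac).
exact: superclass_of_trans H (superclass_of_trans (superclass_of_sym ac) ab).
Qed.

Lemma regular_supercharacter :
  supercharacter (@regular_character R (algGroup A)).
Proof.
split; [exact: regular_character_pd | by rewrite /regular_character eqxx |].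
move=> S Ssc x y Sx Sy.
have := eq_superclass 1%g Ssc Sx Sy; rewrite superclass_of0 /= => xy.
by rewrite /regular_character; congr ((nat_of_bool _)%:R); apply/eqP/eqP => /xy.
Qed.

(** Summing [perturbed_regular_pd] over d in [s] gives 2|s| times the regular character plus e times
    the indicators of [s] and of its inverse; the factor 1/(2|s|) restores the value 1 at the
    identity. *)
Lemma perturbed_regular_supercharacter (e : R[i]) (s : seq (algGroup A)) z :
    e^* = e -> e * e = 1 -> z != 1%g -> uniq s ->
    superclass_of (alg_part z) = [set` s] ->
  supercharacter (fun g => regular_character R g +
    (2 * (size s)%:R)^-1 * e * ((g \in s)%:R + ((g^-1)%g \in s)%:R)).
Proof.
move=> eJ ee z1 us sE.
have zs : z \in s.
  have : superclass_of (alg_part z) z by case: (z); exact: superclass_of_refl.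
  by rewrite sE.
have s1 : 1%g \notin s.
  apply/negP => s1; have : superclass_of (alg_part z) 1%g by rewrite sE.
  move=> /superclass_of_sym; rewrite superclass_of0.
  by case: z z1 {zs sE} => a /eqP.
have sz0 : (size s)%:R != 0 :> R[i].
  by rewrite pnatr_eq0 size_eq0; apply: contraTneq zs => ->.
split.
- rewrite (_ : (fun g => _) = fun g => (2 * (size s)%:R)^-1 *
      \sum_(d <- s) (2 * regular_character R g +
        e * ((g == d)%:R + ((g^-1)%g == d)%:R))).
    apply: pdZ; first by rewrite invr_ge0 mulr_ge0 // ler0n.
    apply: pd_sum => d ds; apply: perturbed_regular_pd => //.
    by apply: contraNneq s1 => <-.
  apply/funext => g; rewrite big_split /= -!mulr_sumr big_split /=.
  rewrite !sum_eq_indicator // big_const_seq count_predT iter_addr_0 -mulr_natr.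
  by field.
- rewrite invg1 (negPf s1) addr0 mulr0 addr0.
  by rewrite /regular_character eqxx.
- move=> S Ssc x y Sx Sy.
  have [_ _ regE] := regular_supercharacter.
  rewrite (regE _ Ssc _ _ Sx Sy).
  have inE g : g \in s <-> superclass_of (alg_part z) g by rewrite sE.
  (* The inverse of a superclass is again a superclass, so the second indicator is constant on
     superclasses too. *)
  have inVE g : g^-1%g \in s <-> superclass_of (alg_part z^-1%g) g.
    rewrite inE; split=> /superclass_of_inv; first by rewrite invgK.
    by rewrite invgK.
  have -> : (x \in s) = (y \in s).
    by apply/idP/idP => /inE/(eq_superclass z Ssc Sx Sy)/inE.
  have -> // : (x^-1%g \in s) = (y^-1%g \in s).
  by apply/idP/idP => /inVE/(eq_superclass z^-1%g Ssc Sx Sy)/inVE.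
Qed.

End Superclass.

Local Close Scope ring_scope.

Theorem theorem3p3 (R : realType) (K : fieldType) (A : nilAlgType K)
    (countK : countable [set: K]) (countA : countable [set: A]) :
  @indecomposable_supercharacter R K A (@regular_character R (algGroup A)) <->
  [set C : set (algGroup A) | superclass C /\ finite_set C] =
    [set [set 1%g]].
Proof.
split=> [[_ extr]|fin1].
  apply/seteqP; split=> [S [[a _ <-]]|_ ->] /=; last first.
    by split; [exists 0%R => //; exact: superclass_of0 | exact: finite_set1].
  (* Duplicates are removed so that each element of the class is counted once in the average. *)
  move=> /finite_seqP[s0 sE]; pose s := undup s0.
  have us : uniq s by exact: undup_uniq.
  have {}sE : superclass_of a = [set` s].
    by rewrite sE; apply/seteqP; split=> x /=; rewrite mem_undup.
  have [a0|a0] := eqVneq (OnePlus a) 1%g.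
    by case: a0 => ->; exact: superclass_of0.
  have as_ : OnePlus a \in s.
    by have := superclass_of_refl a; rewrite sE.
  have sch (e : R[i]) (eJ : (e^* = e)%R) (ee : (e * e = 1)%R) :=
    perturbed_regular_supercharacter eJ ee a0 us sE.
  (* The signs 1 and -1 give two supercharacters whose midpoint is the regular character. *)
  have sch1 := sch 1%R (rmorph1 _) (mulr1 _).
  have schN1 := sch (-1)%R (rmorphN1 _) (etrans (mulrNN _ _) (mulr1 _)).
  have half01 : (0 < (2^-1 : R) < 1)%R.
    by rewrite invr_gt0 invf_lt1 // ltr0n ltr1n.
  have [|/(congr1 (@^~ (OnePlus a))) + _] := extr _ _ _ sch1 schN1 half01.
    move=> x; rewrite (_ : (1 - 2^-1)%:C%C = (2^-1)%:C%C :> R[i])%R; last first.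
      by congr (_%:C%C)%R; field.
    rewrite mulr1 mulrN1 !mulNr -mulrDr addrACA subrr addr0 mulrDr -mulrDl.
    rewrite -rmorphD /= (_ : 2^-1 + 2^-1 = 1 :> R)%R ?mul1r //.
    by field.
  (* Extremality kills the perturbation, but at 1 + a it equals 1/(2|s|) times 1 or 2; this could
     vanish only for empty [s], and [s] contains 1 + a. *)
  rewrite as_ mulr1 => /eqP; rewrite eq_sym addrC -subr_eq subrr eq_sym.
  rewrite mulf_eq0 invr_eq0 mulf_eq0 !pnatr_eq0 /= size_eq0 -natrD pnatr_eq0.
  by rewrite orbF => /eqP s_nil; rewrite s_nil in as_.
have regE f : f 1%g = 1%R -> (forall x, x != 1%g -> f x = 0%R) ->
    f = @regular_character R (algGroup A).
  move=> f1 f0; apply/funext => x; rewrite /regular_character.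
  by have [->|/f0] := eqVneq x 1%g.
split=> [|f1 f2 t [pd1 f11 sc1] [pd2 f21 sc2] t01 fE].
  exact: regular_supercharacter.
(* A finite class of x would be {1} by hypothesis, although it contains x; and a class containing 1
   is the class of 0. *)
have infinite_class (x : algGroup A) : x != 1%g ->
    infinite_set (superclass_of (alg_part x)) /\
    ~ superclass_of (alg_part x) 1%g.
  case: x => a a1; split=> [fin|/superclass_of_sym]; last first.
    by rewrite superclass_of0 => /eqP; exact/negP.
  have : [set [set 1%g]] (superclass_of a).
    by rewrite -fin1; split; first exists a.
  move=> /= aE; have := superclass_of_refl a; rewrite aE => /eqP; exact/negP.
have class_const (f : algGroup A -> R[i]) :
    (forall C, superclass C -> forall x y, C x -> C y -> f x = f y) ->
    forall x y, superclass_of (alg_part x) y -> f y = f x.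
  move=> fC [a] y ay; apply: fC ay _; first by exists a.
  exact: superclass_of_refl.
split; apply: regE => // x /infinite_class[xinf x1].
  apply: (regular_component_eq0 pd1 pd2 f11 t01 fE xinf x1).
  exact: class_const sc1 x.
(* For f2 the same argument applies with the components exchanged and 1 - t as weight. *)
have s01 : (0 < 1 - t < 1)%R.
  by case/andP: t01 => t0 t1; rewrite subr_gt0 t1 gtrBl.
apply: (regular_component_eq0 pd2 pd1 f21 s01 _ xinf x1 (class_const _ sc2 x)).
by move=> g; rewrite fE addrC opprB addrCA subrr addr0.
Qed.
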